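(* Let $G$ be a topological group and let $X$ be a minimal $G$-flow. Then the map $\pi_X:S_G(X)\to X$ is the universal highly proximal extension of $X$; that is, $\pi_X$ is highly proximal, and for every minimal $G$-flow $Y$ and every highly proximal $G$-map $\phi:Y\to X$ there is a $G$-map $\psi:S_G(X)\to Y$ with $\pi_X=\phi\circ\psi$.
   Context: All groups and spaces are Hausdorff. For a topological group $G$, a $G$-flow is a nonempty compact space $X$ with a continuous action $G\times X\to X$. It is minimal if every orbit is dense. A $G$-map between $G$-flows is a continuous map commuting with the $G$-actions. A $G$-map $\phi:Y\to X$ between minimal $G$-flows is highly proximal if every nonempty open $B\subseteq Y$ contains a fiber $\phi^{-1}(\{x\})$ for some $x\in X$. Let $\mathcal{N}_G$ be the collection of symmetric open neighborhoods of the identity in $G$, and $\mathrm{op}(X)$ the collection of nonempty open subsets of $X$. For $U\subseteq G$ and $A\subseteq X$, $UA=\{ga: g\in U, a\in A\}$. A near filter is a family $\mathcal{F}\subseteq \mathrm{op}(X)$ such that for any $A_1,\dots,A_k\in\mathcal{F}$ and any $U\in\mathcal{N}_G$ we have $UA_1\cap\cdots\cap UA_k\neq\emptyset$. A near ultrafilter is a maximal (with respect to inclusion) near filter. $S_G(X)$ is the set of near ultrafilters on $\mathrm{op}(X)$, with the topology generated by the basic open sets $N_A=\{p\in S_G(X): A\notin p\}$, $A\in\mathrm{op}(X)$. $G$ acts on $S_G(X)$ by: $A\in gp$ iff $g^{-1}A\in p$, for $A\in \mathrm{op}(X)$. With this topology and action $S_G(X)$ is a $G$-flow, and it is minimal when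 $X$ is. For each $p\in S_G(X)$ there is a unique point $x_p\in X$ such that every open neighborhood of $x_p$ belongs to $p$. The $G$-map $\pi_X:S_G(X)\to X$ is defined by $\pi_X(p)=x_p$. *)

(* Defs.v *)
From HB Require Import structures.
From mathcomp Require Import all_boot.
From mathcomp Require Import boolp classical_sets functions cardinality filter.
From mathcomp Require Import topology.

Set Implicit Arguments.
Unset Strict Implicit.
Unset Printing Implicit Defensive.

Local Open Scope classical_set_scope.
Local Open Scope group_scope.

HB.mixin Record isTopologicalGroup G & Topological G & Group G := {
  mulg_continuous : continuous (fun x : G * G => x.1 * x.2) ;
  invg_continuous : continuous (fun x : G => x^-1)
}.

#[short(type="topologicalGroupType")]
HB.structure Definition TopologicalGroup :=
  {G of Topological G & Group G & isTopologicalGroup G}.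

HB.mixin Record isFlow (G : topologicalGroupType) X & Topological X := {
  act : G -> X -> X ;
  act1g : forall x, act 1 x = x ;
  actMg : forall g h x, act (g * h) x = act g (act h x) ;
  act_continuous : continuous (fun z : G * X => act z.1 z.2) ;
  flow_neq0 : [set: X] !=set0 ;
  flow_compact : compact [set: X] ;
  flow_hausdorff : hausdorff_space X
}.

#[short(type="flowType")]
HB.structure Definition Flow (G : topologicalGroupType) :=
  {X of Topological X & isFlow G X}.

Section FlowDefs.
Variable G : topologicalGroupType.

Definition flow_orbit (X : flowType G) (x : X) : set X := range (act^~ x).

Definition minimal_flow (X : flowType G) := forall x : X, dense (flow_orbit x).

Definition gmap (Y X : flowType G) (phi : Y -> X) :=
  continuous phi /\ forall g y, phi (act g y) = act g (phi y).

Definition highly_proximal (Y X : flowType G) (phi : Y -> X) :=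
  [/\ minimal_flow Y, minimal_flow X, gmap phi &
      forall B : set Y, open B -> B !=set0 ->
        exists x : X, phi @^-1` [set x] `<=` B].

Definition symmetric_nbhs : set (set G) :=
  [set U | [/\ open U, U 1 & forall g, U g -> U g^-1]].

Definition op (X : topologicalType) : set (set X) :=
  [set A | open A /\ A !=set0].

Section NearFilters.
Variable X : flowType G.

Definition act_set (U : set G) (A : set X) : set X :=
  [set act g a | g in U & a in A].

(* The intersection over an empty S is X, which is nonempty. *)
Definition near_filter (F : set (set X)) :=
  F `<=` @op X /\
  forall S : set (set X), finite_set S -> S `<=` F ->
  forall U, symmetric_nbhs U -> \bigcap_(A in S) act_set U A !=set0.

Definition near_ultrafilter (p : set (set X)) :=
  near_filter p /\ forall q, near_filter q -> p `<=` q -> q = p.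

End NearFilters.
End FlowDefs.

Section FlowTheory.
Variables (G : topologicalGroupType) (X : flowType G).
Implicit Types (A B : set X) (U V : set G) (g h : G) (p q F S : set (set X)).

Local Notation NG := (@symmetric_nbhs G).

Lemma actVK g : cancel (act g : X -> X) (act g^-1).
Proof. by move=> x; rewrite -actMg mulVg act1g. Qed.

Lemma actKV g : cancel (act g^-1 : X -> X) (act g).
Proof. by move=> x; rewrite -actMg mulgV act1g. Qed.

Lemma act_image g A : act g @` A = act g^-1 @^-1` A.
Proof.
apply/seteqP; split=> [_ [x Ax <-] /=|x /= Ax]; first by rewrite actVK.
by exists (act g^-1 x) => //; rewrite actKV.
Qed.

Lemma act_imageM g h A : act (g * h) @` A = act g @` (act h @` A).
Proof.
apply/seteqP; split=> [_ [x Ax <-]|_ [_ [x Ax <-] <-]].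
  by rewrite actMg; exists (act h x) => //; exists x.
by exists x => //; rewrite actMg.
Qed.

Lemma act_image1 A : act (1 : G) @` A = A.
Proof.
apply/seteqP; split=> [_ [x Ax <-]|x Ax]; first by rewrite act1g.
by exists x => //; rewrite act1g.
Qed.

Lemma continuous_act g : continuous (act g : X -> X).
Proof.
move=> x; apply: (@continuous_comp _ _ _ (fun x => (g, x))
  (fun z : G * X => act z.1 z.2)); last exact: act_continuous.
by apply: cvg_pair => /=; [exact: cvg_cst|exact: cvg_id].
Qed.

Lemma open_act g A : open A -> open (act g @` A).
Proof. by move=> oA; rewrite act_image; apply: open_comp => // x _; exact: continuous_act. Qed.

Lemma op_act g A : op A -> op (act g @` A).
Proof. by move=> [oA [x Ax]]; split; [exact: open_act|exists (act g x); exists x]. Qed.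

Lemma open_act_set U A : open A -> open (act_set U A).
Proof.
move=> oA; rewrite (_ : act_set U A = \bigcup_(g in U) (act g @` A)).
  by apply: bigcup_open => g _; exact: open_act.
apply/seteqP; split=> [_ [g Ug [a Aa <-]]|_ [g Ug [a Aa <-]]].
  by exists g => //; exists a.
by exists g => //; exists a.
Qed.

Lemma sub_act_set U A : NG U -> A `<=` act_set U A.
Proof. by move=> [_ U1 _] a Aa; exists 1 => //; exists a => //; rewrite act1g. Qed.

Lemma act_setS U V A B : U `<=` V -> A `<=` B -> act_set U A `<=` act_set V B.
Proof. by move=> UV AB _ [g /UV Vg [a /AB Ba <-]]; exists g => //; exists a. Qed.

Lemma NG_setI U V : NG U -> NG V -> NG (U `&` V).
Proof.
move=> [oU U1 UV] [oV V1 VV]; split; first exact: openI.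
  by [].
by move=> g [/UV ? /VV ?].
Qed.

Lemma NG_setT : NG setT.
Proof. by split=> //; exact: openT. Qed.

Lemma NG_open U : open U -> U 1 -> exists2 V, NG V & V `<=` U.
Proof.
move=> oU U1; exists (U `&` (fun g => g^-1) @^-1` U); last exact: subIsetl.
split; first by apply: openI => //; apply: open_comp => // x _; exact: invg_continuous.
  by split=> //=; rewrite invg1.
by move=> g [Ug UVg]; split=> //=; rewrite invgK.
Qed.

Lemma mulg_cts2 (f1 f2 : G -> G) : continuous f1 -> continuous f2 ->
  continuous (fun x => f1 x * f2 x).
Proof.
move=> c1 c2 x; apply: (@continuous_comp _ _ _ (fun x => (f1 x, f2 x))
  (fun z : G * G => z.1 * z.2)); last exact: mulg_continuous.
by apply: cvg_pair; [exact: c1|exact: c2].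
Qed.

Lemma NG_conj g U : NG U -> NG [set h | U (g^-1 * h * g)].
Proof.
move=> [oU U1 UV]; split => /=.
- apply: open_comp oU => x _; apply: mulg_cts2; last by move=> ?; exact: cvg_cst.
  by apply: mulg_cts2 => ?; [exact: cvg_cst|exact: cvg_id].
- by rewrite mulg1 mulVg.
- by move=> h /UV; rewrite !invgM invgK mulgA.
Qed.

Lemma NG_half U : NG U ->
  exists2 V, NG V & forall g h, V g -> V h -> U (g * h).
Proof.
move=> [oU U1 UV].
have : nbhs (1 : G, 1 : G) ((fun z : G * G => z.1 * z.2) @^-1` U).
  by apply: mulg_continuous => /=; rewrite mulg1; exact: open_nbhs_nbhs.
case=> -[/= P Q] [nP nQ] PQU.
move: nP nQ; rewrite !nbhsE => -[P' [oP' P'1] P'P] [Q' [oQ' Q'1] Q'Q].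
have [V NV VPQ] := NG_open (openI oP' oQ') (conj P'1 Q'1).
exists V => // g h /VPQ[/P'P Pg _] /VPQ[_ /Q'Q Qh].
exact: (PQU (g, h)).
Qed.

Lemma NG_half_sub U V A : (forall g h, V g -> V h -> U (g * h)) ->
  act_set V (act_set V A) `<=` act_set U A.
Proof.
move=> VU _ [g Vg [_ [h Vh [a Aa <-]] <-]].
by exists (g * h); [exact: VU|exists a => //; rewrite actMg].
Qed.

Lemma nuf_mem p A : near_ultrafilter p -> op A ->
  (forall S, finite_set S -> S `<=` p -> forall U, NG U ->
    act_set U A `&` \bigcap_(B in S) act_set U B !=set0) -> p A.
Proof.
move=> [[p_op pF] pmax] opA AS.
have <- : p `|` [set A] = p; last by right.
apply: pmax; last by move=> B; left.
split; first by move=> B [/p_op|->].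
move=> S fS SpA U NU; have fS' := finite_setD [set A] fS.
have [|x [Ax Sx]] := AS (S `\` [set A]) fS' _ U NU.
  by move=> B [/SpA[//|->] /(_ erefl)].
exists x => B SB; have [->//|BA] := pselect (B = A).
by apply: Sx; split.
Qed.

Lemma nuf_notin p A : near_ultrafilter p -> op A -> ~ p A ->
  exists S, exists2 U, [/\ finite_set S, S `<=` p & NG U] &
    act_set U A `&` \bigcap_(B in S) act_set U B = set0.
Proof.
move=> nup opA npA; apply: contrapT => H; apply: npA.
apply: nuf_mem => // S fS Sp U NU; apply/set0P/eqP => e.
by apply: H; exists S, U.
Qed.

Lemma nuf_sub p A B : near_ultrafilter p -> open B -> A `<=` B -> p A -> p B.
Proof.
move=> nup oB AB pA; have [[p_op pF] _] := nup.
have [oA [x Ax]] := p_op _ pA.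
apply: nuf_mem => //; first by split=> //; exists x; exact: AB.
move=> S fS Sp U NU; have [||y Hy] := pF (S `|` [set A]) _ _ U NU.
- by rewrite finite_setU; split=> //; exact: finite_set1.
- by move=> C [/Sp|->].
exists y; split; last by move=> C SC; apply: Hy; left.
by apply: (act_setS (@subset_refl _ _) AB); apply: Hy; right.
Qed.

Lemma open_fin_bigcap S (f : set X -> set X) : finite_set S ->
  (forall B, S B -> open (f B)) -> open (\bigcap_(B in S) f B).
Proof.
move=> /finite_seqP[s ->] fo; rewrite bigcap_seq big_seq.
elim/big_ind: _ => //; [exact: openT|by move=> ? ?; exact: openI].
Qed.

Lemma nuf_dense p A B : near_ultrafilter p -> open A -> open B ->
  dense (A `|` B) -> p A \/ p B.
Proof.
move=> nup oA oB dAB; have [[p_op pF] _] := nup.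
apply: contrapT => /not_orP[npA npB].
have key C : open C -> ~ p C -> exists S, exists2 U,
    [/\ finite_set S, S `<=` p & NG U] &
    act_set U C `&` \bigcap_(B in S) act_set U B = set0.
  move=> oC npC; have [->|/eqP/set0P C0] := pselect (C = set0).
    exists set0, setT; first by split=> //; exact: NG_setT.
    by rewrite -subset0 => x [[g _ [y []]]].
  by apply: nuf_notin.
have [S [U [fS Sp NU] US0]] := key _ oA npA.
have [S' [U' [fS' Sp' NU'] US0']] := key _ oB npB.
have [||x Hx] := pF (S `|` S') _ _ _ (NG_setI NU NU').
- by rewrite finite_setU.
- by move=> C [/Sp|/Sp'].
have oW : open (\bigcap_(C in S `|` S') act_set (U `&` U') C).
  apply: open_fin_bigcap; first by rewrite finite_setU.
  by move=> C SC; apply: open_act_set; have [] : op C by case: SC => [/Sp|/Sp'] /p_op.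
have [y [Wy ABy]] := dAB _ (ex_intro _ x Hx) oW.
case: ABy => yAB.
- suff : set0 y by [].
  rewrite -US0; split; first exact: sub_act_set.
  by move=> C SC; apply: (act_setS (@subIsetl _ U U') (@subset_refl _ _)); apply: Wy; left.
- suff : set0 y by [].
  rewrite -US0'; split; first exact: sub_act_set.
  by move=> C SC; apply: (act_setS (@subIsetr _ U U') (@subset_refl _ _)); apply: Wy; right.
Qed.

Lemma nuf_extend F : near_filter F -> exists2 p, near_ultrafilter p & F `<=` p.
Proof.
move=> nF; pose P : set (set (set X)) := [set q | near_filter (q `|` F)].
have [|A [PA Amax]] := @Zorn_bigcup _ P.
  move=> C CP Ctot; have [->|/eqP/set0P[q0 Cq0]] := pselect (C = set0).
    by rewrite /P /= bigcup_set0 set0U.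
  split=> [B [[q Cq qB]|FB]|S fS SF U NU].
  - by have [+ _] := CP _ Cq; apply; left.
  - by have [+ _] := nF; apply.
  have [q Cq Sq] : exists2 q, C q & S `<=` q `|` F.
    move: fS SF => /finite_seqP[s ->]; elim: s => [|B s IHs] sF.
      by exists q0.
    have [C' Cs|q Cq sq] := IHs; first by apply: sF; rewrite /= inE Cs orbT.
    have [[q' Cq' q'B]|FB] := sF B (mem_head _ _).
      have [qq'|q'q] := Ctot _ _ Cq Cq'.
        exists q' => // D; rewrite /= inE => /orP[/eqP->|/sq[/qq'|]]; by [left|right].
      exists q => // D; rewrite /= inE => /orP[/eqP->|/sq//]; by left; exact: q'q.
    by exists q => // D; rewrite /= inE => /orP[/eqP->|/sq//]; right.
  by have [_] := CP _ Cq; apply.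
exists (A `|` F); last by move=> B; right.
split=> // q nq AFq; have [qA|nqA] := pselect (q `<=` A).
  by apply/seteqP; split=> // B /qA; left.
exfalso; apply: (Amax q); first by split=> // B AB; apply: AFq; left.
by rewrite /P /= setUidl// => B FB; apply: AFq; right.
Qed.

End FlowTheory.

Record near_ultrafilters (G : topologicalGroupType) (X : flowType G) :=
  NearUltrafilter {
    nuf_set :> set (set X) ;
    nufP : near_ultrafilter nuf_set
  }.

Section SGTopology.
Variables (G : topologicalGroupType) (X : flowType G).

Local Notation S_ := (near_ultrafilters X).

Lemma near_ultrafilter_eq (p q : S_) : nuf_set p `<=` nuf_set q -> p = q.
Proof.
case: p q => [p np] [q nq] /= pq.
have e : q = p by have [_] := np; apply => //; have [] := nq.
by rewrite e in nq *; congr NearUltrafilter; exact: Prop_irrelevance.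
Qed.

HB.instance Definition _ := gen_eqMixin S_.
HB.instance Definition _ := gen_choiceMixin S_.

Definition nuf_avoid (A : set X) : set S_ := [set p : S_ | ~ nuf_set p A].

HB.instance Definition _ := isSubBaseTopological.Build S_ (@op X) nuf_avoid.

Lemma open_nuf_avoid (A : set X) : op A -> open (nuf_avoid A).
Proof.
move=> opA; exists [set nuf_avoid A]; last by rewrite bigcup_set1.
by move=> _ ->; exact: finI_from1.
Qed.

Lemma cvg_nuf (F : set_system S_) (p : S_) : Filter F ->
  (forall A, op A -> ~ nuf_set p A -> F (nuf_avoid A)) -> F --> p.
Proof.
move=> FF Fp W; rewrite nbhsE => -[B [[D DE DB] Bp] BW].
apply: filterS BW _; move: Bp; rewrite -DB => -[C DC Cp].
have CB : C `<=` B by rewrite -DB => q Cq; exists C.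
rewrite DB; apply: filterS CB _.
have [E Eop EC] := DE _ DC.
rewrite -EC; apply: (@filter_bigI _ _ E) => A AE; apply: Fp; first by have /set_mem := Eop _ AE.
by move: Cp; rewrite -EC; apply.
Qed.

Lemma nuf_act_subproof (g : G) (p : S_) :
  near_ultrafilter [set A | nuf_set p (act g^-1 @` A)].
Proof.
have act_near q h : near_filter q -> near_filter [set A : set X | q (act h^-1 @` A)].
  move=> [q_op qF]; split=> [A /q_op/(op_act h)|S fS Sq U NU].
    by rewrite -act_imageM mulgV act_image1.
  have [||x Hx] := qF [set act h^-1 @` A | A in S] _ _ _ (NG_conj h^-1 NU).
  - exact: finite_image.
  - by move=> _ [A SA <-]; exact: Sq.
  exists (act h x) => A SA.
  have [k] := Hx _ (ex_intro2 _ _ A SA erefl); rewrite /= invgK => Uk.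
  move=> [_ [a Aa <-] <-]; exists (h * k * h^-1) => //; exists a => //.
  by rewrite !actMg.
have [nq qmax] := nufP p; split; first exact: act_near.
move=> q nqq pq; apply/seteqP; split=> // A qA /=.
suff <- : [set A | q (act g^-1^-1 @` A)] = p.
  by rewrite /= -act_imageM mulVg act_image1.
apply: qmax; first exact: act_near.
move=> B pB; apply: pq; rewrite /= -act_imageM mulgV.
by rewrite act_image1.
Qed.

Definition nuf_act (g : G) (p : S_) : S_ := NearUltrafilter (nuf_act_subproof g p).

Lemma nuf_act1 (p : S_) : nuf_act 1 p = p.
Proof. by apply: near_ultrafilter_eq => A /=; rewrite invg1 act_image1. Qed.

Lemma nuf_actM (g h : G) (p : S_) : nuf_act (g * h) p = nuf_act g (nuf_act h p).
Proof. by apply: near_ultrafilter_eq => A /=; rewrite invgM act_imageM. Qed.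

Lemma nuf_act_continuous : continuous (fun z : G * S_ => nuf_act z.1 z.2).
Proof.
move=> [g p]; apply: cvg_nuf => A opA /= npA.
have [S [U [fS Sp NU] US0]] := nuf_notin (nufP p) (op_act g^-1 opA) npA.
have [V NV VU] := NG_half NU; have [oV V1 VV] := NV.
pose B := act_set V (act g^-1 @` A).
have opB : op B.
  have [oA [x Ax]] := op_act g^-1 opA.
  by split; [exact: open_act_set|exists x; exact: sub_act_set].
have npB : ~ nuf_set p B.
  move=> pB; have [[_ pF] _] := nufP p.
  have [||x Hx] := pF (S `|` [set B]) _ _ _ (NG_setI NV NU).
  - by rewrite finite_setU; split.
  - by move=> C [/Sp|->].
  suff : set0 x by [].
  rewrite -US0; split.
    apply: (NG_half_sub VU); apply: (act_setS (@subIsetl _ V U) (@subset_refl _ _)).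
    by apply: Hx; right.
  move=> C SC; apply: (act_setS (@subIsetr _ V U) (@subset_refl _ _)).
  by apply: Hx; left.
exists ([set h | V (h^-1 * g)], nuf_avoid B).
  split=> /=; last by apply: open_nbhs_nbhs; split=> //; exact: open_nuf_avoid.
  apply: open_nbhs_nbhs; split=> /=; last by rewrite mulVg.
  apply: open_comp oV => x _; apply: mulg_cts2; last by move=> ?; exact: cvg_cst.
  exact: invg_continuous.
move=> [h q] /= [Vh nqB] /= qA; apply: nqB.
apply: (nuf_sub (nufP q)) qA; first by case: opB.
move=> _ [a Aa <-]; exists (h^-1 * g) => //; exists (act g^-1 a); first by exists a.
by rewrite actMg actKV.
Qed.

Lemma nuf_neq0 : [set: S_] !=set0.
Proof.
have [|p np _] := @nuf_extend _ X set0; last by exists (NearUltrafilter np).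
split=> // S _ S0 U _; have -> : S = set0 by rewrite -subset0.
rewrite bigcap_set0.
exact: flow_neq0.
Qed.

Lemma nuf_compact : compact [set: S_].
Proof.
rewrite compact_ultra => F UF _.
have FF : ProperFilter F by exact: ultra_proper.
pose q : set (set X) := [set A | F [set p : S_ | nuf_set p A]].
have [|p np qp] := @nuf_extend _ X q.
  split=> [A qA|S fS Sq U NU].
    have [p pA] := @filter_ex _ F FF _ qA.
    by have [[+ _] _] := nufP p; apply.
  have : F (\bigcap_(A in S) [set p : S_ | nuf_set p A]).
    move: fS Sq => /finite_fsetP[E ->] Eq.
    by apply: filter_bigI => A AE; exact: Eq.
  by move=> /filter_ex[p Sp]; have [[_ pF] _] := nufP p; exact: pF.
exists (NearUltrafilter np); split=> //; apply: cvg_nuf => A opA /= npA.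
have [FA|//] := in_ultra_setVsetC [set p : S_ | nuf_set p A] UF.
by case: npA; apply: qp.
Qed.

Lemma nuf_hausdorff : hausdorff_space S_.
Proof.
rewrite open_hausdorff => p q pq.
have [A pA nqA] : exists2 A, nuf_set p A & ~ nuf_set q A.
  apply: contrapT => H; move/eqP: pq; apply.
  apply: near_ultrafilter_eq => A pA; apply: contrapT => nqA.
  by apply: H; exists A.
have [[p_op pF] _] := nufP p; have [[q_op qF] _] := nufP q.
have opA := p_op _ pA; have [oA [a Aa]] := opA.
have [S [U [fS Sq NU] US0]] := nuf_notin (nufP q) opA nqA.
have [V NV VU] := NG_half NU.
pose B := act_set V A.
have oB : open B by exact: open_act_set.
have opB : op B by split=> //; exists a; exact: sub_act_set.
have nqB : ~ nuf_set q B.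
  move=> qB.
  have [||x Hx] := qF (S `|` [set B]) _ _ _ (NG_setI NV NU).
  - by rewrite finite_setU; split.
  - by move=> C [/Sq|->].
  suff : set0 x by [].
  rewrite -US0; split.
    apply: (NG_half_sub VU); apply: (act_setS (@subIsetl _ V U) (@subset_refl _ _)).
    by apply: Hx; right.
  move=> C SC; apply: (act_setS (@subIsetr _ V U) (@subset_refl _ _)).
  by apply: Hx; left.
pose D := (~` B)^°.
have oD : open D by exact: open_interior.
have dBD : dense (B `|` D).
  move=> O [x Ox] oO; apply: contrapT => H.
  have DO : O `<=` D.
    by rewrite -open_subsetE // => y Oy By; apply: H; exists y; split=> //; left.
  by apply: H; exists x; split=> //; right; exact: DO.
have npD : ~ nuf_set p D.
  move=> pD; have [W NW WV] := NG_half NV.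
  have [||x Hx] := pF [set A; D] _ _ _ NW.
  - by [].
  - by move=> C [->|->].
  have [g Wg [b Ab gbx]] := Hx _ (or_introl erefl).
  have [h Wh [d Dd hdx]] := Hx _ (or_intror erefl).
  have := interior_subset Dd; apply; exists (h^-1 * g).
    by apply: WV => //; have [_ _] := NW; apply.
  by exists b => //; rewrite actMg gbx -hdx actVK.
have D0 : D !=set0.
  have [qB|qD] := nuf_dense (nufP q) oB oD dBD; first by case: (nqB qB).
  by have [] := q_op _ qD.
exists (nuf_avoid D, nuf_avoid B); first by split; rewrite inE.
split; [exact: open_nuf_avoid|exact: open_nuf_avoid|].
apply/eqP; rewrite -subset0 => r [nrD nrB].
by have [] := nuf_dense (nufP r) oB oD dBD.
Qed.

HB.instance Definition _ := isFlow.Build G S_ nuf_act1 nuf_actM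
  nuf_act_continuous nuf_neq0 nuf_compact nuf_hausdorff.

Lemma nuf_actE (g : G) (p : S_) (A : set X) :
  nuf_set (act g p) A = nuf_set p (act g^-1 @` A).
Proof. by []. Qed.

Lemma nuf_limit_ex (p : S_) :
  exists x : X, forall V, open V -> V x -> nuf_set p V.
Proof.
pose D : set (set (set X) * set G) :=
  [set SU | [/\ finite_set SU.1, SU.1 `<=` p & symmetric_nbhs SU.2]].
pose W (SU : set (set X) * set G) := \bigcap_(A in SU.1) act_set SU.2 A.
have [[_ pF] _] := nufP p.
have WF : ProperFilter (filter_from D W).
  apply: filter_from_proper; last by move=> [S U] [fS Sp NU]; exact: pF.
  apply: filter_from_filter.
    by exists (set0, setT); split=> //; exact: NG_setT.
  move=> [S U] [S' U'] [/= fS Sp NU] [/= fS' Sp' NU'].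
  exists (S `|` S', U `&` U').
    split=> /=; [by rewrite finite_setU|by move=> A [/Sp|/Sp']|exact: NG_setI].
  move=> x Hx; split=> A SA.
    apply: (act_setS (@subIsetl _ U U') (@subset_refl _ _)).
    by apply: Hx; left.
  apply: (act_setS (@subIsetr _ U U') (@subset_refl _ _)).
  by apply: Hx; right.
have [x [_ clx]] := @flow_compact _ X _ WF filterT.
exists x => V oV Vx; apply: (nuf_mem (nufP p)).
  by split=> //; exists x.
move=> S fS Sp U NU.
have [||y [Wy Vy]] := clx (W (S, U)) V.
- by exists (S, U).
- exact: open_nbhs_nbhs.
by exists y; split=> //; exact: sub_act_set.
Qed.

Lemma nuf_limit_unique (p : S_) (x y : X) :
  (forall V, open V -> V x -> nuf_set p V) ->
  (forall V, open V -> V y -> nuf_set p V) -> x = y.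
Proof.
move=> px py; apply/eqP/negP => /negP xy.
have := @flow_hausdorff _ X; rewrite open_hausdorff => /(_ _ _ xy).
move=> [[A B] [/= /set_mem Ax /set_mem By] [oA oB /eqP AB]].
have shrink (C : set X) (z : X) : open C -> C z ->
    exists U V, [/\ symmetric_nbhs U, open V, V z & act_set U V `<=` C].
  move=> oC Cz.
  have : nbhs (1 : G, z) ((fun t : G * X => act t.1 t.2) @^-1` C).
    by apply: act_continuous => /=; rewrite act1g; exact: open_nbhs_nbhs.
  case=> -[/= P Q] [nP nQ] PQC.
  move: nP nQ; rewrite !nbhsE => -[P' [oP' P'1] P'P] [V [oV Vz] VQ].
  have [U NU UP] := NG_open oP' P'1.
  exists U, V; split=> // _ [g Ug [v Vv <-]].
  by apply: (PQC (g, v)); split; [exact/P'P/UP|exact: VQ].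
have [U [V [NU oV Vx UVA]]] := shrink _ _ oA Ax.
have [U' [V' [NU' oV' Vy UVB]]] := shrink _ _ oB By.
have [[_ pF] _] := nufP p.
have [||z Hz] := pF [set V; V'] _ _ _ (NG_setI NU NU').
- by [].
- by move=> C [->|->]; [exact: px|exact: py].
suff : set0 z by [].
rewrite -AB; split.
  by apply: UVA; apply: (act_setS (@subIsetl _ U U') (@subset_refl _ _));
     apply: Hz; left.
by apply: UVB; apply: (act_setS (@subIsetr _ U U') (@subset_refl _ _));
   apply: Hz; right.
Qed.

Definition pi_map (p : S_) : X := projT1 (cid (nuf_limit_ex p)).

Lemma pi_mapP (p : S_) (V : set X) : open V -> V (pi_map p) -> nuf_set p V.
Proof. by rewrite /pi_map; case: cid => x /= px oV Vx; exact: px. Qed.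

End SGTopology.

(* Main.v *)
Require Import Defs.
From mathcomp Require Import all_boot.
From mathcomp Require Import boolp classical_sets functions topology.
From mathcomp Require Import cardinality filter.

(** The proof rests on the dual image of a map phi : Y -> X, which sends a set
    V in Y to the set phi_*(V) of points whose whole fiber lies in V.  When phi
    is a highly proximal map of flows, phi_* sends nonempty open sets to
    nonempty open sets, so a near ultrafilter p on X can be tested on the
    dual images of the neighborhoods of a point y of Y: say that p converges to
    y along phi if phi_*(V) belongs to p for all open V containing y.

    Every p converges along phi to exactly one point.  A cluster point of the
    preimages of the sets [UA_1 /\ ... /\ UA_k], with A_i in p, is a limit
    because high proximality turns an open subset of Y meeting such a preimage
    into a fiber that lies over this intersection (lemma [nuf_cvg_along_ex]).
    For uniqueness, if phi_*(A) is in p and p converges to y, then y is in the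
    closure of A: otherwise all translates of some neighborhood of y by elements
    close to the identity would be disjoint from A, while two members of p are
    near each other (lemma [nuf_cvg_along_closure]).  The same closure
    property, with regularity of Y, shows that the limit depends continuously
    on p, and uniqueness shows that it is equivariant and compatible with phi.
    This limit is the required map psi.  Convergence along the identity of X is
    the definition of pi_X, so the same lemma shows that pi_X is a G-map.

    High proximality of pi_X comes from the form of the topology on near
    ultrafilters: finitely many sets A_i outside q can be separated from q by
    one nonempty open W and one neighborhood U of the identity with W disjoint
    from every UA_i.  A near ultrafilter lying over a point of W contains W,
    hence no A_i.  So every nonempty open set contains the preimage of a
    nonempty open W (lemma [pi_map_preimage_sub]); minimality follows by moving
    the image of a given point into W. *)

Set Implicit Arguments.
Unset Strict Implicit.
Unset Printing Implicit Defensive.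

Local Open Scope classical_set_scope.
Local Open Scope group_scope.

(** * Near sets *)

Section Nearness.
Variables (G : topologicalGroupType) (X : flowType G).
Implicit Types (A B V W : set X) (U : set G) (p : near_ultrafilters X).

Lemma act_set_nbhs A x : open A -> A x ->
  exists U V, [/\ symmetric_nbhs U, open V, V x & act_set U V `<=` A].
Proof.
move=> oA Ax.
have : nbhs (1 : G, x) ((fun t : G * X => act t.1 t.2) @^-1` A).
  by apply: act_continuous => /=; rewrite act1g; exact: open_nbhs_nbhs.
case=> -[/= P Q] [nP nQ] PQA.
move: nP nQ; rewrite !nbhsE => -[P' [oP' P'1] P'P] [V [oV Vx] VQ].
have [U NU UP] := NG_open oP' P'1.
exists U, V; split=> // _ [g Ug [v Vv <-]].
by apply: (PQA (g, v)); split; [exact/P'P/UP|exact: VQ].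
Qed.

(** Near filters only provide a common point of UA and UB; by symmetry and
    halving of neighborhoods, a single translate of a point of A reaches B. *)
Lemma nuf_near p A B U : nuf_set p A -> nuf_set p B -> symmetric_nbhs U ->
  exists2 g, U g & exists2 a, A a & B (act g a).
Proof.
move=> pA pB NU; have [V NV VU] := NG_half NU; have [_ _ Vinv] := NV.
have [[_ pF] _] := nufP p.
have [||x Hx] := pF [set A; B] _ _ _ NV.
- by [].
- by move=> C [->|->].
have [g Vg [a Aa gax]] := Hx _ (or_introl erefl).
have [h Vh [b Bb hbx]] := Hx _ (or_intror erefl).
exists (h^-1 * g); first exact: VU (Vinv _ Vh) Vg.
by exists a => //; rewrite actMg gax -hbx actVK.
Qed.

(** Each A outside p is excluded by finitely many members of p; pooling these
    for all A in s leaves a finite part of p, whose neighborhoods still meet.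
    A near ultrafilter containing W then lies in the basic open set of those
    avoiding every A in s. *)
Lemma nuf_notin_seq p (s : seq (set X)) :
  (forall A, A \in s -> op A /\ ~ nuf_set p A) ->
  exists U W, [/\ symmetric_nbhs U, op W &
    forall A, A \in s -> act_set U A `&` W = set0].
Proof.
move=> sp.
(* The witness W is the intersection of the sets UB for B in a finite part S of p *)
suff [S [U [fS Sp NU Us0]]] : exists S U, [/\ finite_set S,
    S `<=` nuf_set p, symmetric_nbhs U & forall A, A \in s ->
    act_set U A `&` \bigcap_(B in S) act_set U B = set0].
  have [[p_op pF] _] := nufP p.
  exists U, (\bigcap_(B in S) act_set U B); split=> //.
  split; last exact: pF.
  by apply: open_fin_bigcap => // B /Sp/p_op[oB _]; exact: open_act_set.
elim: s sp => [|A s IHs] sp.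
  by exists set0, setT; split=> //; exact: NG_setT.
have [|S [U [fS Sp NU Us0]]] := IHs.
  by move=> B Bs; apply: sp; rewrite inE Bs orbT.
have [opA npA] := sp A (mem_head _ _).
have [S' [U' [fS' Sp' NU'] US0']] := nuf_notin (nufP p) opA npA.
exists (S `|` S'), (U `&` U'); split.
- by rewrite finite_setU.
- by move=> B [/Sp|/Sp'].
- exact: NG_setI.
move=> B; rewrite inE => Bs; rewrite -subset0 => x [UBx Sx].
case/predU1P: Bs => [BA|Bs].
  rewrite -US0'; split=> [|C SC].
    by rewrite -BA; apply: act_setS UBx => // g [].
  by apply: act_setS (Sx C (or_intror SC)) => // g [].
rewrite -(Us0 B Bs); split=> [|C SC]; first by apply: act_setS UBx => // g [].
by apply: act_setS (Sx C (or_introl SC)) => // g [].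
Qed.

End Nearness.

(** * Dual images along highly proximal maps *)

Definition dual_image (T1 T2 : Type) (f : T1 -> T2) (B : set T1) : set T2 :=
  [set x | f @^-1` [set x] `<=` B].

Section HighlyProximal.
Variables (G : topologicalGroupType) (Y X : flowType G) (phi : Y -> X).
Hypothesis hp : highly_proximal phi.

(** The image is closed because Y is compact, and it contains an orbit. *)
Lemma highly_proximal_surj x : exists y, phi y = x.
Proof.
have [_ minX [cphi ephi] _] := hp.
suff : (range phi) x by move=> [y _ <-]; exists y.
have clY : closed (range phi).
  apply: compact_closed; first exact: flow_hausdorff.
  apply: continuous_compact; last exact: flow_compact.
  exact: continuous_subspaceT.
apply: clY => B /nbhs_interior Bx; have [y0 _] := @flow_neq0 _ Y.
have [|z [Bz [g _ gz]]] := minX (phi y0) _ _ (@open_interior _ B).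
  by exists x; apply: nbhs_singleton.
by exists z; split; [exists (act g y0)|exact: interior_subset Bz]; rewrite ?ephi.
Qed.

(** The complement of a dual image is the image of a compact set. *)
Lemma open_dual_image B : open B -> open (dual_image phi B).
Proof.
have [_ _ [cphi _] _] := hp => oB.
rewrite (_ : dual_image phi B = ~` (phi @` ~` B)).
  rewrite openC; apply: compact_closed; first exact: flow_hausdorff.
  apply: continuous_compact; first exact: continuous_subspaceT.
  by apply: subclosed_compact (@flow_compact _ Y) _ => //; rewrite closedC.
apply/seteqP; split=> [x xB [y nBy yx]|x nx y yx]; first exact/nBy/xB.
by apply: contrapT => nBy; apply: nx; exists y.
Qed.

Lemma op_dual_image B : op B -> op (dual_image phi B).
Proof.
have [_ _ _ hpB] := hp => -[oB B0]; split; first exact: open_dual_image.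
by have [x xB] := hpB B oB B0; exists x.
Qed.

Lemma dual_image_preimage A : dual_image phi (phi @^-1` A) = A.
Proof.
apply/seteqP; split=> [x xA|x Ax y /= ->//].
by have [y yx] := highly_proximal_surj x; rewrite -yx; apply: xA.
Qed.

Lemma act_dual_image g B :
  dual_image phi (act g @` B) = act g @` dual_image phi B.
Proof.
have [_ _ [_ ephi] _] := hp; rewrite !act_image; apply/seteqP.
split=> x xB y /= yx.
  have /xB /= : phi (act g y) = x by rewrite ephi yx actKV.
  by rewrite actVK.
by apply: xB => /=; rewrite ephi yx.
Qed.

(** * Convergence of near ultrafilters along a map *)

Definition nuf_cvg_along (p : near_ultrafilters X) (y : Y) :=
  forall V, open V -> V y -> nuf_set p (dual_image phi V).

(** A limit y is a cluster point of the pullback to Y of the filter of near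
    intersections of p.  By maximality of p, it suffices that phi_*(V) meets
    each of these intersections, and a fiber witnesses this. *)
Lemma nuf_cvg_along_ex p : exists y, nuf_cvg_along p y.
Proof.
pose D : set (set (set X) * set G) :=
  [set SU | [/\ finite_set SU.1, SU.1 `<=` nuf_set p & symmetric_nbhs SU.2]].
pose W (SU : set (set X) * set G) := \bigcap_(A in SU.1) act_set SU.2 A.
have [[p_op pF] _] := nufP p; have [_ _ [cphi _] hpB] := hp.
have FF : ProperFilter (filter_from D (fun SU => phi @^-1` W SU)).
  apply: filter_from_proper; last first.
    move=> [S U] [fS Sp NU]; have [x Wx] := pF S fS Sp U NU.
    by have [y yx] := highly_proximal_surj x; exists y; rewrite /= yx.
  apply: filter_from_filter.
    by exists (set0, setT); split=> //; exact: NG_setT.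
  move=> [S U] [S' U'] [/= fS Sp NU] [/= fS' Sp' NU'].
  exists (S `|` S', U `&` U').
    split=> /=; [by rewrite finite_setU|by move=> A [/Sp|/Sp']|exact: NG_setI].
  move=> y Wy; split=> A SA.
    by apply: act_setS (Wy A (or_introl SA)) => // g [].
  by apply: act_setS (Wy A (or_intror SA)) => // g [].
have [y [_ cly]] := @flow_compact _ Y _ FF filterT.
exists y => V oV Vy; apply: (nuf_mem (nufP p)).
  by apply: op_dual_image; split=> //; exists y.
move=> S fS Sp U NU.
have oW : open (W (S, U)).
  by apply: open_fin_bigcap => // A /Sp/p_op[oA _]; exact: open_act_set.
have [||x xWV] := hpB (phi @^-1` W (S, U) `&` V).
- by apply: openI => //; apply: open_comp => // ? _; exact: cphi.
- by apply: cly; [exists (S, U)|exact: open_nbhs_nbhs].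
exists x; have [z zx] := highly_proximal_surj x; split.
  by apply: sub_act_set => // t /xWV[].
by have [+ _] := xWV z zx; rewrite /= zx.
Qed.

(** If y is outside the closure of A, some UV misses A, with V a neighborhood
    of y.  Since phi_*(V) and phi_*(A) are in p, an element of U moves a fiber
    contained in V onto a fiber contained in A; fibers are nonempty, so UV
    meets A. *)
Lemma nuf_cvg_along_closure p y A : nuf_cvg_along p y ->
  nuf_set p (dual_image phi A) -> closure A y.
Proof.
have [_ _ [_ ephi] _] := hp => py pA; apply: contrapT => ncly.
have oC : open (~` closure A) by rewrite openC; exact: closed_closure.
have [U [V [NU oV Vy UVA]]] := act_set_nbhs oC ncly.
have [g Ug [x Vx Agx]] := nuf_near (py V oV Vy) pA NU.
have [z zx] := highly_proximal_surj x.
apply: (UVA (act g z)); first by exists g => //; exists z => //; exact: Vx.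
by apply: subset_closure; apply: Agx => /=; rewrite ephi zx.
Qed.

Lemma nuf_cvg_along_unique p y z :
  nuf_cvg_along p y -> nuf_cvg_along p z -> y = z.
Proof.
move=> py pz; apply: contrapT => /eqP yz.
have := @flow_hausdorff _ Y; rewrite open_hausdorff => /(_ _ _ yz).
move=> [[A B] [/= /set_mem Ay /set_mem Bz] [oA oB /eqP AB0]].
have /(_ B) := nuf_cvg_along_closure pz (py A oA Ay).
by rewrite AB0 => /(_ (open_nbhs_nbhs (conj oB Bz)))[].
Qed.

(** If V is a neighborhood of the limit of p and W a smaller one with closure
    in V, the dual image of the complement A of this closure avoids p, and any
    q that avoids it has its limit outside A. *)
Lemma nuf_cvg_along_gmap (psi : near_ultrafilters X -> Y) :
  (forall p, nuf_cvg_along p (psi p)) -> gmap psi.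
Proof.
move=> cpsi; split=> [p V Vp|g p].
  have regY : {for psi p, regular_space Y}.
    exact: compact_regular (@flow_hausdorff _ Y) (@flow_compact _ Y) filterT.
  have [W Wp WV] := regY _ Vp.
  pose A := ~` closure W.
  have oA : open A by rewrite openC; exact: closed_closure.
  have npA : ~ nuf_set p (dual_image phi A).
    move=> /(nuf_cvg_along_closure (cpsi p))/(_ _ Wp)[z [nclz Wz]].
    exact/nclz/subset_closure.
  have psiA q : ~ nuf_set q (dual_image phi A) -> V (psi q).
    by move=> nqA; apply: WV; apply: contrapT => Aq; exact: nqA (cpsi q A oA Aq).
  (* Basic open sets are indexed by nonempty sets, so the dual image must be nonempty *)
  have [A0|/set0P nA0] := eqVneq A set0.
    apply: (@filterE _ (nbhs p)) => q; apply: WV; apply: contrapT => Aq.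
    by suff : set0 (psi q) by []; rewrite -A0.
  apply: (@filterS _ (nbhs p)) psiA _; apply: open_nbhs_nbhs; split=> //.
  by apply: open_nuf_avoid; apply: op_dual_image.
apply: (nuf_cvg_along_unique (cpsi (act g p))) => V oV Vgp.
rewrite nuf_actE -act_dual_image; apply: cpsi; first exact: open_act.
by exists (act g (psi p)) => //; rewrite actVK.
Qed.

End HighlyProximal.

(** * The limit map of near ultrafilters *)

Section LimitMap.
Variables (G : topologicalGroupType) (X : flowType G).
Hypothesis minX : minimal_flow X.

Lemma highly_proximal_id : highly_proximal (@id X).
Proof.
split=> //; first by split=> // x; exact: cvg_id.
by move=> B _ [x Bx]; exists x => _ ->.
Qed.

(** Dual images along the identity are the sets themselves, so convergence
    along it is the defining property of pi_X. *)
Lemma pi_map_gmap : gmap (@pi_map G X).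
Proof.
apply: (nuf_cvg_along_gmap highly_proximal_id) => p V oV Vp.
by rewrite (dual_image_preimage highly_proximal_id V); exact: pi_mapP.
Qed.

Lemma pi_map_preimage_sub (B : set (near_ultrafilters X)) :
  open B -> B !=set0 -> exists2 W, op W & @pi_map G X @^-1` W `<=` B.
Proof.
move=> oB [q Bq]; move: oB Bq => [D DE <-] [C DC Cq].
have [E Eop EC] := DE C DC; rewrite -EC in Cq.
have [|U [W [NU opW UW0]]] := @nuf_notin_seq G X q (finmap.enum_fset E).
  by move=> A AE; split; [exact/set_mem/Eop|exact: Cq].
exists W => // p Wp; suff Cp : C p by exists C.
rewrite -EC => A AE pA.
have pW : nuf_set p W by apply: pi_mapP => //; case: opW.
have [g Ug [a Aa Wga]] := nuf_near pA pW NU.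
by have : set0 (act g a) by rewrite -(UW0 A AE); split=> //; exists g => //; exists a.
Qed.

(** A translate of p whose image lies in W lies in B. *)
Lemma minimal_near_ultrafilters : minimal_flow (near_ultrafilters X).
Proof.
move=> p B B0 oB; have [W [oW W0] WB] := pi_map_preimage_sub oB B0.
have [_ epi] := pi_map_gmap.
have [x [Wx [g _ gx]]] := minX (pi_map p) W0 oW.
exists (act g p); split; last by exists g.
by apply: WB; rewrite /= epi gx.
Qed.

Lemma pi_map_highly_proximal : highly_proximal (@pi_map G X).
Proof.
split; [exact: minimal_near_ultrafilters|exact: minX|exact: pi_map_gmap|].
move=> B oB /(pi_map_preimage_sub oB)[W [_ [x Wx]] WB].
by exists x => p px; apply: WB; rewrite /= px.
Qed.

End LimitMap.

Theorem theorem3p2 (G : topologicalGroupType) (hG : hausdorff_space G)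
    (X : flowType G) (hX : minimal_flow X) :
  highly_proximal (@pi_map G X) /\
  forall (Y : flowType G) (phi : Y -> X),
    minimal_flow Y -> highly_proximal phi ->
    exists psi : near_ultrafilters X -> Y,
      gmap psi /\ @pi_map G X = phi \o psi.
Proof.
split; first exact: pi_map_highly_proximal.
move=> Y phi _ hp; have [_ _ [cphi _] _] := hp.
have [psi cpsi] := choice (nuf_cvg_along_ex hp).
exists psi; split; first exact: nuf_cvg_along_gmap hp _ cpsi.
apply/funext => p; apply: (@nuf_limit_unique _ _ p); first exact: pi_mapP.
move=> V oV Vp; rewrite -(dual_image_preimage hp V); apply: cpsi => //.
by apply: open_comp => // y _; exact: cphi.
Qed.
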